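(* Let $q=3^k$ with $k$ a positive even integer, and let $\mu_{q+1}=\{x\in\mathbb{F}_{q^2} : x^{q+1}=1\}$. Then the function $$g(x)=\frac{-x^7+x^6+x}{x^6+x-1}$$ permutes $\mu_{q+1}$.
   Context: $\mathbb{F}_{q^2}$ is the finite field with $q^2$ elements and $\mu_{q+1}$ is the group of $(q+1)$-th roots of unity in it. A rational function ''permutes'' a set $S$ if it induces a well-defined bijection of $S$ onto itself. *)

(* Defs.v *)
From HB Require Import structures.
From mathcomp Require Import all_boot all_order all_algebra.
Set Implicit Arguments.
Unset Strict Implicit.
Unset Printing Implicit Defensive.
Import GRing.Theory.
Local Open Scope ring_scope.

Definition mu (F : finFieldType) (n : nat) : {set F} := [set x : F | x ^+ n == 1].

(* The first clause is well-definedness: division in mathcomp is total, so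
   without it a pole in S would silently get a value. *)
Definition ratfun_permutes (F : finFieldType) (N D : {poly F}) (S : {set F}) : Prop :=
  [/\ {in S, forall x, D.[x] != 0},
      {in S &, injective (fun x => N.[x] / D.[x])}
    & [set N.[x] / D.[x] | x in S] = S].

(* Main.v *)
(** Put a, b for [form_a], [form_b], and g = N/D. Over characteristic 3,
    [N(x) D(y) - N(y) D(x) = (x - y) (a(x,y)^2 + b(x,y)^2)].
    This splitting is explained by the supersingular curve t^2 = s^3 - s: up to
    a change of coordinate, g is the map that an endomorphism of degree 7
    induces on the t-line, the quotient by the automorphism s |-> s + 1 of
    order 3. The six nonzero points of the kernel form two orbits under that
    automorphism, which give the two factors a + i b and a - i b, i^2 = -1.

    On mu_{q+1} the q-Frobenius is inversion, and it exchanges a and b up to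
    the factor -1/(xy)^3. Since k is even, i lies in F_q; so a = i b or
    a = -i b forces a = b = 0. But (x^2+1)^3 (y^2+1)^3 lies in the ideal (a, b),
    and x^2 + 1 does not vanish on mu_{q+1}. *)

Require Import Defs.
From mathcomp Require Import all_boot all_order all_algebra all_field.
From mathcomp Require Import ring.
Import GRing.Theory.
Local Open Scope ring_scope.

(* The [ring] tactic rewrites with a constant hypothesis [c = 0] only at
   coefficients equal to [c], so each multiple of 3 that occurs is needed. *)
Lemma mul3_eq0 (F : fieldType) : 3%:R = 0 :> F ->
  [/\ 6%:R = 0 :> F, 9%:R = 0 :> F & 12%:R = 0 :> F].
Proof.
move=> h3; have h n : (3 * n)%:R = 0 :> F by rewrite natrM h3 mul0r.
by split; [exact: (h 2) | exact: (h 3) | exact: (h 4)].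
Qed.

Lemma mul3N_eq0 (F : fieldType) : 3%:R = 0 :> F ->
  [/\ - 3%:R = 0 :> F, - 6%:R = 0 :> F, - 9%:R = 0 :> F & - 12%:R = 0 :> F].
Proof.
by move=> h3; have [h6 h9 h12] := mul3_eq0 F h3; rewrite h3 h6 h9 h12 oppr0.
Qed.

Definition form_a (F : fieldType) (x y : F) : F :=
  (- 1 + y + y ^+ 2 + y ^+ 3) + x * (- 1 - y + y ^+ 2 + y ^+ 3)
  + x ^+ 2 * (y - y ^+ 2 + y ^+ 3) + x ^+ 3 * (- y ^+ 2 - y ^+ 3).

Definition form_b (F : fieldType) (x y : F) : F :=
  (1 + y) + x * (- 1 + y - y ^+ 2) + x ^+ 2 * (- 1 - y + y ^+ 2 + y ^+ 3)
  + x ^+ 3 * (- 1 - y - y ^+ 2 + y ^+ 3).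

Lemma ratfun_cross_factor (F : fieldType) (x y : F) : 3%:R = 0 :> F ->
  (- x ^+ 7 + x ^+ 6 + x) * (y ^+ 6 + y - 1)
  - (- y ^+ 7 + y ^+ 6 + y) * (x ^+ 6 + x - 1)
  = (x - y) * (form_a F x y ^+ 2 + form_b F x y ^+ 2).
Proof.
move=> h3; rewrite /form_a /form_b; apply/eqP; rewrite -subr_eq0; apply/eqP.
have [h6 h9 h12] := mul3_eq0 F h3; have [n3 n6 n9 n12] := mul3N_eq0 F h3.
ring: h3 h6 h9 h12 n3 n6 n9 n12.
Qed.

Lemma forms_bezout (F : fieldType) (x y : F) : 3%:R = 0 :> F ->
  (x ^+ 2 + 1) ^+ 3 * (y ^+ 2 + 1) ^+ 3 =
  (- 1 + y - y ^+ 2 + y ^+ 3 - x - x * y ^+ 3 + x ^+ 2 + x ^+ 2 * y ^+ 3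
   - x ^+ 3 + x ^+ 3 * y - x ^+ 3 * y ^+ 2 - x ^+ 3 * y ^+ 3) * form_a F x y
  + (- y - y ^+ 3 + x - x * y + x * y ^+ 2 + x ^+ 2 + x ^+ 2 * y
     - x ^+ 2 * y ^+ 2 - x ^+ 2 * y ^+ 3 - x ^+ 3 + x ^+ 3 * y
     + x ^+ 3 * y ^+ 2) * form_b F x y.
Proof.
move=> h3; rewrite /form_a /form_b; apply/eqP; rewrite -subr_eq0; apply/eqP.
have [h6 h9 h12] := mul3_eq0 F h3; have [n3 n6 n9 n12] := mul3N_eq0 F h3.
ring: h3 h6 h9 h12 n3 n6 n9 n12.
Qed.

Lemma two_neq0_of_three_eq0 (F : fieldType) : 3%:R = 0 :> F -> 2%:R != 0 :> F.
Proof.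
move=> h3; apply: contra_neq (oner_neq0 F) => h2.
by rewrite -[1](addrK 2%:R) -[1 + 2%:R]/(1%:R + 2%:R) -natrD h3 h2 subrr.
Qed.

Section FrobeniusOnRootsOfUnity.

Variables (F : finFieldType) (m : nat).
Hypothesis char3 : 3 \in [pchar F].
Let q := (3 ^ m)%N.

Let three0 : 3%:R = 0 :> F.
Proof. exact: pcharf0 char3. Qed.

Let q_gt0 : (0 < q)%N.
Proof. by rewrite /q expn_gt0. Qed.

Let frobD (x y : F) : (x + y) ^+ q = x ^+ q + y ^+ q.
Proof. by apply: exprDn_pchar; rewrite (eq_pnat _ (pcharf_eq char3)) pnatX. Qed.

Let frobN (x : F) : (- x) ^+ q = - x ^+ q.
Proof. by apply: exprNn_pchar; rewrite (eq_pnat _ (pcharf_eq char3)) pnatX. Qed.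

Let frobX n (x : F) : (x ^+ n) ^+ q = (x ^+ q) ^+ n.
Proof. exact: exprAC. Qed.

Let frobE := (frobD, frobN, @exprMn F, frobX, @expr1n F).

Lemma mu_neq0 x : x \in mu F q.+1 -> x != 0.
Proof.
by rewrite inE; apply: contraTneq => ->; rewrite expr0n eq_sym oner_eq0.
Qed.

Lemma mu_frob x : x \in mu F q.+1 -> x ^+ q = x^-1.
Proof.
move=> xS; have x0 := mu_neq0 x xS; move: xS; rewrite inE exprS => /eqP xq.
by apply: (mulfI x0); rewrite xq divff.
Qed.

(** Frobenius inverts [x], and the numerator is the reciprocal polynomial x^7 D(1/x) of the
    denominator D, so Frobenius swaps the two up to x^7. *)
Lemma frob_num x : x \in mu F q.+1 ->
  (- x ^+ 7 + x ^+ 6 + x) ^+ q = (x ^+ 6 + x - 1) / x ^+ 7.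
Proof.
by move=> xS; have x0 := mu_neq0 x xS; rewrite !frobE mu_frob //; field.
Qed.

Lemma frob_den x : x \in mu F q.+1 ->
  (x ^+ 6 + x - 1) ^+ q = (- x ^+ 7 + x ^+ 6 + x) / x ^+ 7.
Proof.
by move=> xS; have x0 := mu_neq0 x xS; rewrite !frobE mu_frob //; field.
Qed.

(** By Frobenius a zero of D is also a zero of N, and N + x D = x^2 (x^4 + 1) gives x^4 = -1. Modulo
    this relation D becomes -(x + 1)^2 in characteristic 3, so x = -1, whose fourth power is 1. *)
Lemma den_neq0 x : x \in mu F q.+1 -> x ^+ 6 + x - 1 != 0.
Proof.
move=> xS; have x0 := mu_neq0 x xS; apply/eqP => D0.
have N0 : - x ^+ 7 + x ^+ 6 + x = 0.
  have /eqP := frob_den x xS.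
  by rewrite D0 expr0n gtn_eqF // eq_sym mulf_eq0 invr_eq0 expf_eq0 /= (negPf x0)
     orbF => /eqP.
have x4 : x ^+ 4 = - 1.
  apply/eqP; rewrite -addr_eq0; apply/eqP/(mulfI (expf_neq0 2 x0)).
  rewrite mulr0 -[RHS](addr0 0) -{1}N0 -(mulr0 x) -D0; ring.
have /eqP : (x + 1) ^+ 2 = 0.
  rewrite (_ : _ ^+ 2 = 3%:R * x - (x ^+ 6 + x - 1) + (x ^+ 4 + 1) * x ^+ 2).
    by rewrite three0 D0 x4 addNr !mul0r subrr addr0.
  ring.
rewrite expf_eq0 /= addr_eq0 => /eqP xN1.
move/eqP: x4; rewrite xN1 -addr_eq0 => /eqP h.
by case/eqP: (two_neq0_of_three_eq0 F three0); rewrite -h; ring.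
Qed.

Lemma num_neq0 x : x \in mu F q.+1 -> - x ^+ 7 + x ^+ 6 + x != 0.
Proof.
move=> xS; apply: contraNneq (expf_neq0 q (den_neq0 x xS)) => N0.
by rewrite frob_den // N0 mul0r.
Qed.

Lemma ratfun_mu x : x \in mu F q.+1 ->
  (- x ^+ 7 + x ^+ 6 + x) / (x ^+ 6 + x - 1) \in mu F q.+1.
Proof.
move=> xS; have x0 := mu_neq0 x xS; rewrite inE exprS expr_div_n.
rewrite frob_num // frob_den //; apply/eqP; field.
by rewrite x0 num_neq0 ?den_neq0.
Qed.

(** Both forms have degree 3 in each variable, so inverting [x] and [y] reverses their coefficient
    arrays, up to (xy)^3. The reversed array of [form_a] is minus that of [form_b]. *)
Lemma frob_form_a x y : x \in mu F q.+1 -> y \in mu F q.+1 ->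
  form_a F x y ^+ q = - form_b F x y / (x * y) ^+ 3.
Proof.
move=> xS yS; have x0 := mu_neq0 x xS; have y0 := mu_neq0 y yS.
rewrite /form_a /form_b !frobE !mu_frob //; field.
by rewrite x0 y0.
Qed.

Lemma frob_form_b x y : x \in mu F q.+1 -> y \in mu F q.+1 ->
  form_b F x y ^+ q = - form_a F x y / (x * y) ^+ 3.
Proof.
move=> xS yS; have x0 := mu_neq0 x xS; have y0 := mu_neq0 y yS.
rewrite /form_a /form_b !frobE !mu_frob //; field.
by rewrite x0 y0.
Qed.

Hypothesis m_even : ~~ odd m.

Lemma frob_sqrtN1 (e : F) : e ^+ 2 = - 1 -> e ^+ q = e.
Proof.
(* As [m] is even, [q] is a power of 9, while e^4 = 1. *)
move=> e2; have q1 : q = 1 %[mod 4].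
  by rewrite /q -(even_halfK m_even) -mul2n expnM -modnXm exp1n.
by rewrite (divn_eq q 4) q1 exprD mulnC exprM (exprM e 2 2) e2 sqrrN !expr1n mul1r.
Qed.

(** A square root of -1 is fixed by Frobenius, so its (q+1)-th power is its square -1, not 1. *)
Lemma mu_sqr_add1_neq0 x : x \in mu F q.+1 -> x ^+ 2 + 1 != 0.
Proof.
move=> xS; rewrite addr_eq0; apply/eqP => x2; move: xS.
rewrite inE exprS (frob_sqrtN1 x x2) -expr2 x2 eq_sym -addr_eq0.
by apply/negP; exact: two_neq0_of_three_eq0 three0.
Qed.

Lemma forms_eq0 x y : x \in mu F q.+1 -> y \in mu F q.+1 ->
  form_a F x y ^+ 2 + form_b F x y ^+ 2 = 0 ->
  form_a F x y = 0 /\ form_b F x y = 0.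
Proof.
move=> xS yS; have x0 := mu_neq0 x xS; have y0 := mu_neq0 y yS.
have := frob_form_a x y xS yS; have := frob_form_b x y xS yS.
move: (form_a _ _ _) (form_b _ _ _) => a b bq aq ab.
suff a0 : a = 0.
  by move/eqP: ab; rewrite a0 expr0n add0r sqrf_eq0 => /eqP.
apply/eqP/negPn/negP => a0; pose e := b / a.
have e2 : e ^+ 2 = - 1.
  apply/eqP; rewrite -addr_eq0 expr_div_n -(divff (expf_neq0 2 a0)) -mulrDl.
  by rewrite addrC ab mul0r.
have be : b = e * a by rewrite /e divfK.
have w0 : (x * y) ^- 3 != 0 by rewrite invr_neq0 // expf_neq0 ?mulf_neq0.
(* Frobenius applied to b = e a, with [e] fixed, yields -a = -e b = -e^2 a = a. *)
have /(mulIf w0) ha : - a / (x * y) ^+ 3 = (e * - b) / (x * y) ^+ 3.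
  by rewrite -bq {1}be exprMn (frob_sqrtN1 e e2) aq mulrA.
have : 2%:R * a = 0.
  have -> : 2%:R * a = a - - a by ring.
  rewrite ha be (_ : e * - (e * a) = - (e ^+ 2 * a)); last ring.
  by rewrite e2; ring.
by move/eqP; rewrite mulf_eq0 (negPf a0) orbF (negPf (two_neq0_of_three_eq0 F _)).
Qed.

Lemma ratfun_mu_inj x y : x \in mu F q.+1 -> y \in mu F q.+1 ->
  (- x ^+ 7 + x ^+ 6 + x) / (x ^+ 6 + x - 1) =
  (- y ^+ 7 + y ^+ 6 + y) / (y ^+ 6 + y - 1) -> x = y.
Proof.
move=> xS yS /eqP; rewrite eqr_div ?den_neq0 // -subr_eq0.
rewrite ratfun_cross_factor // mulf_eq0 subr_eq0.
case/orP=> [/eqP // | /eqP /(forms_eq0 x y xS yS) [a0 b0]].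
have := mulf_neq0 (expf_neq0 3 (mu_sqr_add1_neq0 x xS))
                  (expf_neq0 3 (mu_sqr_add1_neq0 y yS)).
by rewrite forms_bezout // a0 b0 !mulr0 addr0 eqxx.
Qed.

End FrobeniusOnRootsOfUnity.

Theorem theorem2p3 (k q : nat) (F : finFieldType)
    (hk : (0 < k)%N) (hk_even : ~~ odd k) (hq : q = (3 ^ k)%N)
    (hF : #|F| = (q ^ 2)%N) :
  ratfun_permutes (- 'X^7 + 'X^6 + 'X : {poly F}) ('X^6 + 'X - 1) (mu F q.+1).
Proof.
have char3 : 3 \in [pchar F].
  by apply: (@card_finPcharP F 3 (k * 2)); rewrite // expnM -hq.
have gE x : (- 'X^7 + 'X^6 + 'X : {poly F}).[x] / ('X^6 + 'X - 1).[x]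
          = (- x ^+ 7 + x ^+ 6 + x) / (x ^+ 6 + x - 1) by rewrite !hornerE.
have inj : {in mu F q.+1 &, injective (fun x =>
    (- 'X^7 + 'X^6 + 'X : {poly F}).[x] / ('X^6 + 'X - 1).[x])}.
  by move=> x y xS yS /=; rewrite !gE; apply: (ratfun_mu_inj F k) => //; rewrite -hq.
split=> //.
  by move=> x xS; rewrite !hornerE; apply: (den_neq0 F k) => //; rewrite -hq.
(* By injectivity the image has the size of the whole set, so only the inclusion remains. *)
apply/eqP; rewrite eqEcard card_in_imset // leqnn andbT.
apply/subsetP => _ /imsetP [x xS ->].
by rewrite gE hq; apply: ratfun_mu => //; rewrite -hq.
Qed.
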